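(* Let $G$ be a finite simple graph with maximum degree $\Delta(G)\geq 3$, and let $m,n$ be positive integers with $1<m<n$ and $m$ even. Then $\chi(G^{\frac{m}{n}})=\omega(G^{\frac{m}{n}})$.
   Context: For a graph $G$ and positive integer $n$, the $n$-subdivision $G^{\frac{1}{n}}$ is obtained from $G$ by replacing each edge with a path of length $n$. For a graph $H$ and positive integer $m$, the $m$-th power $H^m$ is the graph on $V(H)$ in which two distinct vertices are adjacent iff their distance in $H$ is at most $m$. The fractional power is $G^{\frac{m}{n}}=(G^{\frac{1}{n}})^m$. $\chi$ denotes the chromatic number and $\omega$ the clique number. *)

(* Defs.v *)
From mathcomp Require Import all_boot.

Set Implicit Arguments.
Unset Strict Implicit.
Unset Printing Implicit Defensive.

Record sgraph := SGraph {
  svertex :> finType;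
  sedge : rel svertex;
  sedge_sym : symmetric sedge;
  sedge_irrefl : irreflexive sedge }.

Definition degree (G : sgraph) (x : G) : nat := #|[set y | sedge x y]|.

Definition max_degree (G : sgraph) : nat := \max_(x : G) degree x.

Definition clique (G : sgraph) (S : {set G}) : bool :=
  [forall x in S, forall y in S, (x != y) ==> sedge x y].

Definition clique_number (G : sgraph) : nat :=
  \max_(S : {set G} | clique S) #|S|.

Definition colorable (G : sgraph) (k : nat) : bool :=
  [exists f : {ffun G -> 'I_k},
    forall x, forall y, sedge x y ==> (f x != f y)].

Lemma colorable_card (G : sgraph) : exists k, colorable G k.
Proof.
exists #|G|; apply/existsP; exists [ffun x => enum_rank x].
apply/forallP=> x; apply/forallP=> y; apply/implyP=> exy; rewrite !ffunE.
by apply: contraTneq exy => /enum_rank_inj ->; rewrite sedge_irrefl.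
Qed.

Definition chromatic_number (G : sgraph) : nat := ex_minn (colorable_card G).

Definition walk (G : sgraph) (k : nat) (x y : G) : bool :=
  [exists p : k.-tuple G, path (@sedge G) x p && (last x p == y)].

(* The least length of a walk from x to y. If x and y lie in different
   components the value is the junk value #|G|, so every use must be guarded
   by [connect]. *)
Definition dist (G : sgraph) (x y : G) : nat :=
  find (fun k => walk k x y) (iota 0 #|G|).

Lemma walk_sym (G : sgraph) k (x y : G) : walk k x y = walk k y x.
Proof.
wlog suff: x y / walk k x y -> walk k y x.
  by move=> H; apply/idP/idP; apply: H.
case/existsP=> p /andP[xp /eqP <-]; apply/existsP.
have sz : size (rev (belast x p)) == k by rewrite size_rev size_belast size_tuple.
exists (Tuple sz); rewrite /= rev_path.
rewrite (eq_path (e' := @sedge G)) => [|u v]; last exact: sedge_sym.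
rewrite xp /=; by case: (tval p) => //= a s; rewrite rev_cons last_rcons.
Qed.

Lemma dist_leP (G : sgraph) (m : nat) (x y : G) :
  reflect (exists2 k, k <= m & walk k x y) (connect (@sedge G) x y && (dist x y <= m)).
Proof.
apply: (iffP andP) => [[cxy dm]|[k km wk]].
  exists (dist x y) => //.
  have hs : has (fun k => walk k x y) (iota 0 #|G|).
    case/connectP: cxy => p xp ->; case/shortenP: xp => q xq Uq _.
    apply/hasP; exists (size q).
      by rewrite mem_iota /= add0n; move/card_uniqP: Uq => /= <-; apply: max_card.
    by apply/existsP; exists (in_tuple q); rewrite /= xq eqxx.
  have := nth_find 0 hs; rewrite nth_iota ?add0n //.
  by rewrite -[X in _ < X](size_iota 0 #|G|) -has_find.
case/existsP: (wk) => p /andP[xp /eqP ly]; split.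
  by apply/connectP; exists p.
apply: leq_trans km; rewrite /dist leqNgt; apply/negP => lt.
have := before_find 0 lt.
rewrite nth_iota ?add0n ?wk //.
by apply: leq_trans lt _; rewrite -[X in _ <= X](size_iota 0 #|G|) find_size.
Qed.

Lemma connect_sedge_sym (G : sgraph) : connect_sym (@sedge G).
Proof. exact: sym_connect_sym (@sedge_sym G). Qed.

Section Power.
Variables (H : sgraph) (m : nat).

Definition power_rel : rel H := fun x y =>
  [&& x != y, connect (@sedge H) x y & dist x y <= m].

Lemma power_sym : symmetric power_rel.
Proof.
move=> x y; rewrite /power_rel eq_sym connect_sedge_sym; congr [&& _, _ & _ <= m].
by apply: eq_find => k; exact: walk_sym.
Qed.

Lemma power_irrefl : irreflexive power_rel.
Proof. by move=> x; rewrite /power_rel eqxx. Qed.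

Definition power : sgraph := SGraph power_sym power_irrefl.
End Power.

Section Subdivision.
Variables (G : sgraph) (n : nat).

(* Each edge of G, as an ordered pair of its ends; of the two orders, the one
   that is increasing for the enumeration of the vertices is kept, so that
   every edge occurs exactly once. *)
Definition oriented_edge : finType :=
  {a : G * G | sedge a.1 a.2 && (enum_rank a.1 < enum_rank a.2)}.

Definition subdiv_vertex : finType := (G + oriented_edge * 'I_n.-1)%type.

(* For k = 0, ..., n, the k-th vertex of the path of length n that replaces the
   edge a: its ends are those of a, and its k-th vertex for 0 < k < n is the
   internal vertex of index k - 1. *)
Definition subdiv_pt (a : oriented_edge) (k : nat) : subdiv_vertex :=
  if k is k'.+1 then
    if insub k' is Some i then inr (a, i) else inl (val a).2
  else inl (val a).1.

Definition subdiv_rel : rel subdiv_vertex := fun x y =>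
  [exists a : oriented_edge, exists k : 'I_n,
    ((x == subdiv_pt a k) && (y == subdiv_pt a k.+1)) ||
    ((y == subdiv_pt a k) && (x == subdiv_pt a k.+1))].

Lemma subdiv_sym : symmetric subdiv_rel.
Proof.
move=> x y; rewrite /subdiv_rel.
by apply: eq_existsb => a; apply: eq_existsb => k; rewrite orbC.
Qed.

Lemma subdiv_irrefl : irreflexive subdiv_rel.
Proof.
move=> x; apply: negbTE; apply/existsP=> -[a /existsP[k]].
rewrite orbb.
case/andP=> /eqP -> /eqP; rewrite /subdiv_pt.
case: k => [[|k] kn] /=.
  case: insubP => //= _ [E]; case/andP: (valP a) => _.
  by rewrite E ltnn.
case: insubP => [i _ Ei|/negP[]]; last by rewrite -ltnS prednK //; case: (n) kn.
by case: insubP => // j _ Ej [Eij]; move: Ej; rewrite -Eij Ei => /n_Sn.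
Qed.

Definition subdivision : sgraph := SGraph subdiv_sym subdiv_irrefl.
End Subdivision.

Definition frac_power (G : sgraph) (m n : nat) : sgraph :=
  power (subdivision G n) m.

(* Main.v *)
Require Import Defs.
From mathcomp Require Import all_boot.
From mathcomp Require Import zify.

Set Implicit Arguments.
Unset Strict Implicit.
Unset Printing Implicit Defensive.

(* Write m = 2r, D = max_degree G and n = 2r + 1 + s. The ball of radius r
   around a vertex of degree D is a clique with rD + 1 elements, so the point is
   to colour with rD + 1 colours: a centre colour and D blocks of r colours.

   The D darts (half-edges) at each vertex get distinct labels x < D, and the r
   points next to the vertex on the dart x get the colours of the block x.
   A colouring is then given by a word on each edge path; the condition is that
   windows of length 2r + 1 have no repetition and that the s middle letters
   stay away from the colours of the other darts. As a word can be prefixed by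
   its first 2r + 1 letters, we may assume s <= 2r.

   If D > 3, the two darts of each edge get different labels by Koenig's
   theorem for the 1-subdivision of G, and the middle is filled from its two
   ends with two other blocks, starting with the colours that are farthest from
   the end in its star.

   If D = 3, a maximum cut splits G into a bipartite graph and a matching, and a
   variant of Koenig's theorem gives labels that agree on the edges of the cut
   and differ on those of the matching.
   - For s <= r the labels are shifted on one side of the cut so that the two
     labels of every edge differ. The middle must then consist of the third
     block, and this is possible as soon as the top levels of this block are in
     opposite orders at the two ends. For a given block the edges with this
     requirement are the union of two matchings, so orders can be chosen.
   - For r < s the labels are kept. On an edge of the cut the common block is
     put in opposite orders at the two ends, and any two orders of the two other
     blocks can be combined in the middle. On an edge of the matching all
     blocks are in opposite orders, and at one of the ends the centre takes
     part in the reversal of the block towards the other end. Again each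
     requirement on the orders comes from one of two matchings, now on the set
     of pairs of a label and a vertex. *)

(** * Labelling darts *)

Lemma exists_minimal (T : finType) (P : pred T) (f : T -> nat) :
  (exists x, P x) -> exists2 x, P x & forall y, P y -> f x <= f y.
Proof. by case=> x Px; case: (arg_minnP f Px) => y; exists y. Qed.

Lemma fiber_labelling (X V : finType) (vtx : X -> V) (D : nat) :
  (forall u, #|[set x | vtx x == u]| <= D) ->
  exists l : {ffun X -> 'I_D}, forall x y, vtx x = vtx y -> l x = l y -> x = y.
Proof.
move=> small; pose F u := enum [set x | vtx x == u].
have ltD x : index x (F (vtx x)) < D.
  by apply: leq_trans (small (vtx x)); rewrite cardE index_mem mem_enum inE.
exists [ffun x => Ordinal (ltD x)] => x y exy; rewrite !ffunE => -[] eqi.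
have xF : x \in F (vtx x) by rewrite mem_enum inE.
have yF : y \in F (vtx y) by rewrite mem_enum inE.
by rewrite -(nth_index x xF) eqi exy nth_index // -exy.
Qed.

(* Koenig's edge colouring theorem in terms of darts (half-edges): [opp] maps a
   dart to the other half of its edge, and darts fixed by [opp] are free. If
   all sides are equal this colours the 1-subdivision of a graph, if no edge
   stays inside a side it colours a bipartite graph. The proof switches a
   Kempe chain, directed so that it cannot come back to the bad edge. *)
Lemma dart_labelling (X V : finType) (vtx : X -> V) (opp : X -> X)
    (side : V -> bool) (D : nat) :
  involutive opp -> 1 < D -> (forall u, #|[set x | vtx x == u]| <= D) ->
  exists l : {ffun X -> 'I_D},
    (forall x y, vtx x = vtx y -> l x = l y -> x = y) /\
    (forall x, opp x != x ->
       (l x == l (opp x)) = (side (vtx x) != side (vtx (opp x)))).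
Proof.
move=> oppK D1 small.
pose P (l : {ffun X -> 'I_D}) :=
  [forall x, forall y, (vtx x == vtx y) ==> (l x == l y) ==> (x == y)].
have PP (l : {ffun X -> 'I_D}) :
    reflect (forall x y, vtx x = vtx y -> l x = l y -> x = y) (P l).
  apply: (iffP idP) => [/forallP H x y /eqP e1 /eqP e2|H].
    by apply/eqP; move: (H x) => /forallP/(_ y)/implyP/(_ e1)/implyP/(_ e2).
  do 2!apply/forallP => ?; apply/implyP=> /eqP e1; apply/implyP=> /eqP e2.
  by apply/eqP; apply: H.
pose bad (l : {ffun X -> 'I_D}) := [set x | (opp x != x) &&
   ((l x == l (opp x)) == (side (vtx x) == side (vtx (opp x))))].
have badC l x : (opp x \in bad l) = (x \in bad l).
  by rewrite !inE oppK eq_sym [l _ == _]eq_sym [side _ == _]eq_sym.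
have [|l /PP linj lmin] := @exists_minimal _ P (fun l => #|bad l|).
  by case: (fiber_labelling small) => l Hl; exists l; apply/PP.
exists l; split=> // x0 nx0; case: (boolP (x0 \in bad l)) => [bx0|]; last first.
  by rewrite inE nx0 /=; case: (l x0 == _); case: (side _ == side _).
exfalso; set u := vtx x0; set y0 := opp x0; set al := l x0.
(* In both cases [ga] is chosen so that [l y0] becomes [inn (vtx y0)] below. A chain could then
   enter the vertex of [y0] only through [y0], after leaving [u] by [x0], whose label is not
   [out u]. *)
have [ga gaal gaP] : exists2 ga, ga != al &
    if side u == side (vtx y0) then l y0 = al else l y0 = ga.
  move: bx0; rewrite inE nx0 /= -/y0 -/u -/al; case: (side u == side (vtx y0)) => e.
    have [ga gaal] : exists ga, ga != al.
      have [E|ne] := eqVneq (Ordinal D1) al; last by exists (Ordinal D1).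
      by exists (Ordinal (ltnW D1)); rewrite -E.
    by exists ga => //; apply/eqP; rewrite eq_sym; case: (al == _) e.
  by exists (l y0); rewrite // eq_sym; move: e; case: (al == _).
(* The labels [out p] and [inn q] agree exactly when the sides of [p] and [q] differ, which is the
   rule for a good edge. *)
pose out p := if side p == side u then ga else al.
pose inn p := if side p == side u then al else ga.
pose R p q := [exists x, [&& opp x != x, vtx x == p, vtx (opp x) == q,
                            l x == out p & l (opp x) == inn q]].
pose C p := connect R u p.
have CR p q : C p -> R p q -> C q.
  by move=> Cp Rpq; apply: connect_trans Cp _; apply: connect1.
have Cpred q : C q -> q = u \/ exists2 p, C p & R p q.
  case/connectP=> s; elim/last_ind: s q => [|s z IH] q; first by left.
  rewrite rcons_path last_rcons => /andP[us zR] ->; right.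
  by exists (last u s) => //; apply/connectP; exists s.
have y0C : ~~ C (vtx y0).
  apply/negP=> /Cpred Cy0; have [E|[p _]] := Cy0.
    move: gaP; rewrite E eqxx => e.
    by move: nx0; rewrite (linj (opp x0) x0) ?eqxx.
  case/existsP=> x /and5P[nx /eqP vx /eqP vx' /eqP lx /eqP lx'].
  have e : opp x = y0.
    apply: linj => //; rewrite lx' /inn eq_sym.
    by move: gaP; case: ifP => _ ->.
  have ex : x = x0 by apply: (inv_inj oppK).
  move: lx; rewrite ex -/al -vx ex -/u /out eqxx => /eqP.
  by rewrite eq_sym (negbTE gaal).
pose sw (c : 'I_D) := if c == al then ga else if c == ga then al else c.
have swK : involutive sw.
  move=> c; rewrite /sw; have [->|ca] := eqVneq c al.
    by rewrite (negbTE gaal) eqxx.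
  by have [->|cg] := eqVneq c ga; rewrite ?eqxx // (negbTE ca) (negbTE cg).
have swinn p : sw (inn p) = out p.
  by rewrite /inn /out /sw; case: (side p == _); rewrite ?(negbTE gaal) eqxx.
have swout p : sw (out p) = inn p by rewrite -swinn swK.
have swid p c : c != inn p -> c != out p -> sw c = c.
  by rewrite /inn /out /sw; case: ifP => _ /negbTE-> /negbTE->.
pose l' := [ffun x => if C (vtx x) then sw (l x) else l x].
have /PP/lmin : forall x y, vtx x = vtx y -> l' x = l' y -> x = y.
  move=> x y e; rewrite !ffunE e; case: ifP => _; last exact: linj.
  by move/(inv_inj swK); apply: linj.
apply/negP; rewrite -ltnNge; apply: proper_card; apply/properP.
have x0l' : x0 \notin bad l'.
  rewrite inE nx0 /= !ffunE -/y0 -/u (negbTE y0C) /C connect0 -/al /sw eqxx.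
  by move: gaP; case: ifP => _ ->; rewrite ?eqxx // (negbTE gaal).
(* At an edge with one end in the chain, the pattern [out], [inn] would prolong the chain, and a
   dart labelled [inn] is the one by which the chain came in, unless it is [x0]. *)
have half x : C (vtx x) -> ~~ C (vtx (opp x)) -> x \in bad l' -> x \in bad l.
  move=> Cx Cy; have [->//|nxx0] := eqVneq x x0.
  rewrite !inE !ffunE Cx (negbTE Cy) => /andP[nx]; rewrite nx /=.
  have [lx|lxo] := eqVneq (l x) (out (vtx x)).
    have lyi : l (opp x) != inn (vtx (opp x)).
      apply: contra Cy => lyi; apply: CR Cx _; apply/existsP; exists x.
      by rewrite nx lx lyi !eqxx.
    rewrite lx swout; move: lyi; rewrite /inn /out.
    case: (side (vtx x)); case: (side (vtx (opp x))); case: (side u) => //=;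
      rewrite ?(eq_sym (l (opp x))) => /negbTE->; 
      by move=> // /eqP<-; rewrite ?(eq_sym al) ?(negbTE gaal).
  have [lx|lxi] := eqVneq (l x) (inn (vtx x)); last by rewrite (swid (vtx x)).
  case: (Cpred _ Cx) => [E|[p Cp]].
    by move: nxx0; rewrite (linj x x0) ?eqxx // lx E /inn eqxx.
  case/existsP=> z /and5P[nz /eqP vz /eqP vz' /eqP lz /eqP lz'].
  have e : opp z = x by apply: linj => //; rewrite lz' lx.
  by move: Cy; rewrite -e oppK vz Cp.
split; last by exists x0.
apply/subsetP=> x; case Cx: (C (vtx x)); case Cy: (C (vtx (opp x))).
- by rewrite !inE !ffunE Cx Cy (inj_eq (inv_inj swK)).
- by apply: half; rewrite ?Cx ?Cy.
- by rewrite -badC -(badC l); apply: half; rewrite ?oppK ?Cx ?Cy.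
- by rewrite !inE !ffunE Cx Cy.
Qed.

(** The elements are taken as darts, the sets [[set x; m1 x]] as vertices and [m2] as the opposite
    map. With two labels, injectivity at the vertices gives the condition for [m1], and equal sides
    give the one for [m2]. *)
Lemma two_matchings_bipartite (T : finType) (m1 m2 : T -> T) :
  involutive m1 -> involutive m2 ->
  exists F : T -> bool, (forall x, m1 x != x -> F (m1 x) = ~~ F x) /\
                        (forall x, m2 x != x -> F (m2 x) = ~~ F x).
Proof.
move=> m1K m2K; pose vtx x := [set x; m1 x].
have vtx_eq x y : vtx x = vtx y -> y = x \/ y = m1 x.
  move=> e; have : y \in vtx x by rewrite e !inE eqxx.
  by rewrite !inE => /orP[]/eqP; [left|right].
have small (u : {set T}) : #|[set x | vtx x == u]| <= 2.
  have [->|[x]] := set_0Vmem [set x | vtx x == u]; first by rewrite cards0.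
  rewrite inE => /eqP <-; apply: (@leq_trans #|vtx x|); last first.
    by rewrite cards2; case: (_ != _).
  by apply: subset_leq_card; apply/subsetP=> y; rewrite inE => /eqP/esym/vtx_eq[]->;
    rewrite !inE eqxx ?orbT.
have [l [linj lm2]] := dart_labelling (fun=> true) m2K (leqnn 2) small.
have two (i j : 'I_2) : i != j -> (i == ord0) = ~~ (j == ord0).
  by case: i j => [[|[|i]] Hi] [[|[|j]] Hj].
exists (fun x => l x == ord0); split=> x nx; apply: two.
  apply: contra nx => /eqP e; apply/eqP; apply: linj => //.
  by rewrite /vtx m1K setUC.
by have := lm2 x nx; rewrite eqxx eq_sym /= => ->.
Qed.

(** A choice of sides with the fewest edges inside the sides works, since otherwise moving [x]
    across would lower their number. *)
Lemma max_cut (T : finType) (e : rel T) : symmetric e -> irreflexive e ->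
  exists side : {ffun T -> bool}, forall x,
    (#|[set y | e x y & side x == side y]|).*2 <= #|[set y | e x y]|.
Proof.
move=> esym eirr.
pose f (s : {ffun T -> bool}) u v : nat := e u v && (s u == s v).
have f_sym s u v : f s u v = f s v u by rewrite /f esym eq_sym.
have [|s _ smin] := @exists_minimal _ predT (fun s => \sum_u \sum_v f s u v).
  by exists [ffun=> true].
have split_at t x : \sum_u \sum_v f t u v =
    (\sum_(v | v != x) f t x v).*2 + \sum_(u | u != x) \sum_(v | v != x) f t u v.
  rewrite (bigD1 x) //= (bigD1 x) //= {1}/f eirr add0n.
  under [X in _ + X = _]eq_bigr => u _ do rewrite (bigD1 x) //=.
  rewrite big_split /= addnA -addnn; congr (_ + _ + _).
  by apply: eq_bigr => u _; rewrite f_sym.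
exists s => x; pose s' := [ffun y => if y == x then ~~ s x else s y].
have := smin s' isT; rewrite !(split_at _ x).
rewrite (_ : \sum_(u | _) \sum_(v | _) f s' u v =
             \sum_(u | u != x) \sum_(v | v != x) f s u v); last first.
  apply: eq_bigr => u /negbTE ux; apply: eq_bigr => v /negbTE vx.
  by rewrite /f !ffunE ux vx.
rewrite leq_add2r leq_double => le.
have card_f : #|[set y | e x y & s x == s y]| = \sum_(v | v != x) f s x v.
  rewrite -sum1_card big_mkcond [RHS]big_mkcond; apply: eq_bigr => y _.
  rewrite inE /f; case: (eqVneq y x) => [->|_]; first by rewrite eirr.
  by case: (_ && _).
have -> : #|[set y | e x y]| =
    \sum_(v | v != x) f s x v + \sum_(v | v != x) f s' x v.
  rewrite -big_split -sum1_card big_mkcond [RHS]big_mkcond /=.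
  apply: eq_bigr => y _; rewrite inE /f !ffunE eqxx.
  case: (eqVneq y x) => [->|_]; first by rewrite eirr.
  by case: (e x y) => //=; case: (s x); case: (s y).
by rewrite card_f -addnn leq_add2l.
Qed.

Lemma matching_involution (T : finType) (R : rel T) : symmetric R ->
  irreflexive R -> (forall x y z, R x y -> R x z -> y = z) ->
  exists2 m : T -> T, involutive m & forall x y, R x y -> m x = y /\ m x != x.
Proof.
move=> Rsym Rirr Rfun; pose m x := odflt x [pick y | R x y].
have mR x y : R x y -> m x = y.
  move=> xy; rewrite /m; case: pickP => [z xz|/(_ y)]; last by rewrite xy.
  exact: Rfun xz xy.
exists m => [x|x y xy]; last first.
  by rewrite (mR x y xy); split=> //; apply: contraTneq xy => ->; rewrite Rirr.
case E: [pick y | R x y] => [y|]; last by rewrite /m E /= E.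
have xy : R x y by move: E; case: pickP => // z xz [<-].
by rewrite (mR x y xy); apply: mR; rewrite Rsym.
Qed.

Lemma two_matchings_colouring (T : finType) (R1 R2 : rel T) :
  symmetric R1 -> irreflexive R1 -> (forall x y z, R1 x y -> R1 x z -> y = z) ->
  symmetric R2 -> irreflexive R2 -> (forall x y z, R2 x y -> R2 x z -> y = z) ->
  exists F : T -> bool, (forall x y, R1 x y -> F y = ~~ F x) /\
                        (forall x y, R2 x y -> F y = ~~ F x).
Proof.
move=> s1 i1 /(matching_involution s1 i1)[m1 m1K m1R].
move=> s2 i2 /(matching_involution s2 i2)[m2 m2K m2R].
have [F [F1 F2]] := two_matchings_bipartite m1K m2K.
by exists F; split=> x y; [case/m1R=> <- /F1|case/m2R=> <- /F2].
Qed.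

Lemma degree_le_max (G : sgraph) (u : G) : degree u <= max_degree G.
Proof. exact: (leq_bigmax (F := @degree G)). Qed.

Lemma graph_labelling (G : sgraph) (D : nat) (side : G -> bool) :
  1 < D -> max_degree G <= D ->
  exists lbl : G -> G -> nat, [/\ forall u v, sedge u v -> lbl u v < D,
    forall u v v', sedge u v -> sedge u v' -> lbl u v = lbl u v' -> v = v' &
    forall u v, sedge u v -> (lbl u v == lbl v u) = (side u != side v)].
Proof.
move=> D1 GD; pose X := {p : G * G | sedge p.1 p.2}.
have oppP (x : X) : sedge (val x).2 (val x).1 by rewrite sedge_sym; apply: valP x.
pose opp (x : X) : X := Sub ((val x).2, (val x).1) (oppP x).
have oppK : involutive opp.
  by move=> x; apply: val_inj; rewrite !SubK /= -surjective_pairing.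
pose vtx (x : X) := (val x).1.
have small u : #|[set x | vtx x == u]| <= D.
  apply: leq_trans (leq_trans (degree_le_max u) GD); rewrite /degree.
  rewrite -(@card_in_imset _ _ (fun x : X => (val x).2)); last first.
    move=> x y; rewrite !inE => /eqP ex /eqP ey exy; apply: val_inj.
    rewrite [val x]surjective_pairing [val y]surjective_pairing.
    by rewrite -/(vtx x) -/(vtx y) ex ey exy.
  apply: subset_leq_card; apply/subsetP=> y /imsetP[x]; rewrite !inE => /eqP <- ->.
  exact: (valP x).
have [l [linj lopp]] := dart_labelling side oppK D1 small.
pose lbl u v := if insub (u, v) is Some x then l x : nat else 0.
pose dart u v (uv : sedge u v) : X :=
  exist (fun p : G * G => is_true (sedge p.1 p.2)) (u, v) uv.
have lblE u v (uv : sedge u v) : lbl u v = l (dart u v uv).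
  rewrite /lbl; case: insubP => [x _ ex|]; last by rewrite uv.
  by congr (nat_of_ord (l _)); apply: val_inj.
exists lbl; split.
- by move=> u v uv; rewrite lblE.
- move=> u v v' uv uv'; rewrite !lblE => /val_inj/linj e.
  by have /(congr1 val) [] := e erefl.
- move=> u v uv; have vu : sedge v u by rewrite sedge_sym.
  rewrite !lblE; have -> : dart v u vu = opp (dart u v uv) by apply: val_inj.
  rewrite (inj_eq val_inj) lopp //.
  by apply/eqP=> /(congr1 val)[e _]; have := uv; rewrite e sedge_irrefl.
Qed.

(** In a maximum cut at most half of the at most three neighbours of a vertex are on its own side,
    hence at most one. *)
Lemma cubic_matching_cut (G : sgraph) : max_degree G <= 3 ->
  exists side : G -> bool, forall u v v', sedge u v -> side u = side v ->
    sedge u v' -> side u = side v' -> v = v'.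
Proof.
move=> G3; have [side cut] := max_cut (@sedge_sym G) (@sedge_irrefl G).
exists side => u v v' uv suv uv' suv'.
have : #|[set y | sedge u y & side u == side y]| <= 1.
  have := leq_trans (cut u) (leq_trans (degree_le_max u) G3); lia.
by move/card_le1_eqP; apply; rewrite inE; apply/andP; split=> //; apply/eqP.
Qed.

(** * Subdivisions and their powers *)

(* The vertex at distance p from u on the path that replaces the edge uv (junk
   if uv is not an edge). *)
Definition edge_pt (G : sgraph) (n : nat) (u v : G) (p : nat) :
    subdiv_vertex G n :=
  if insub (u, v) is Some a then subdiv_pt n a p
  else if insub (v, u) is Some a then subdiv_pt n a (n - p) else inl u.

Lemma edge_of_oriented (G : sgraph) (a : oriented_edge G) :
  sedge (val a).1 (val a).2.
Proof. by case/andP: (valP a). Qed.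

Lemma orientation (G : sgraph) (u v : G) : sedge u v ->
  exists a : oriented_edge G, val a = (u, v) \/ val a = (v, u).
Proof.
move=> uv; have [lt|] := ltnP (enum_rank u) (enum_rank v).
  have h : sedge (u, v).1 (u, v).2 && (enum_rank (u, v).1 < enum_rank (u, v).2).
    by rewrite uv.
  by exists (Sub (u, v) h); left; rewrite SubK.
rewrite leq_eqVlt => /orP[/eqP e|lt].
  by move: uv; rewrite (enum_rank_inj (ord_inj e)) sedge_irrefl.
have h : sedge (v, u).1 (v, u).2 && (enum_rank (v, u).1 < enum_rank (v, u).2).
  by rewrite /= sedge_sym uv.
by exists (Sub (v, u) h); right; rewrite SubK.
Qed.

Lemma edge_pt_fwd (G : sgraph) n (a : oriented_edge G) p :
  edge_pt n (val a).1 (val a).2 p = subdiv_pt n a p.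
Proof. by rewrite /edge_pt -surjective_pairing valK. Qed.

Lemma edge_pt_bwd (G : sgraph) n (a : oriented_edge G) p :
  edge_pt n (val a).2 (val a).1 p = subdiv_pt n a (n - p).
Proof.
rewrite /edge_pt insubF; first by rewrite -surjective_pairing valK.
by case/andP: (valP a) => _ lt /=; rewrite ltnNge (ltnW lt) andbF.
Qed.

Lemma edge_pt_rev (G : sgraph) n (u v : G) p : sedge u v -> p <= n ->
  edge_pt n v u (n - p) = edge_pt n u v p.
Proof.
move=> /orientation[a [] va] pn.
  by have := edge_pt_fwd n a p; have := edge_pt_bwd n a (n - p);
     rewrite va /= => -> ->; rewrite subKn.
by have := edge_pt_fwd n a (n - p); have := edge_pt_bwd n a p;
   rewrite va /= => -> ->.
Qed.

Lemma subdiv_pt_end (G : sgraph) n (a : oriented_edge G) : 0 < n ->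
  subdiv_pt n a n = inl (val a).2.
Proof. by case: n => // n _; rewrite /subdiv_pt insubF // ltnn. Qed.

Lemma subdiv_pt_inner (G : sgraph) n (a : oriented_edge G) p : 0 < p < n ->
  exists2 i : 'I_n.-1, p = i.+1 & subdiv_pt n a p = inr (a, i).
Proof.
case: p => // p /andP[_ pn]; have pn1 : p < n.-1 by lia.
by exists (Ordinal pn1) => //; rewrite /subdiv_pt insubT.
Qed.

Lemma edge_pt0 (G : sgraph) n (u v : G) : 0 < n -> sedge u v ->
  edge_pt n u v 0 = inl u.
Proof.
move=> n0 /orientation[a [] va].
  by have := edge_pt_fwd n a 0; rewrite va /= => ->; rewrite va.
by have := edge_pt_bwd n a 0; rewrite va /= => ->;
   rewrite subn0 subdiv_pt_end // va.
Qed.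

Lemma edge_ptn (G : sgraph) n (u v : G) : 0 < n -> sedge u v ->
  edge_pt n u v n = inl v.
Proof.
by move=> n0 uv; rewrite -edge_pt_rev // subnn edge_pt0 // sedge_sym.
Qed.

Lemma edge_pt_inner (G : sgraph) n (u v : G) p : sedge u v -> 0 < p < n ->
  exists a, exists2 i : 'I_n.-1, edge_pt n u v p = inr (a, i) &
    val a = (u, v) /\ p = i.+1 \/ val a = (v, u) /\ n - p = i.+1.
Proof.
move=> /orientation[a [] va] pn; exists a.
  have [i ei e] := subdiv_pt_inner a pn; exists i; last by left.
  by have := edge_pt_fwd n a p; rewrite va /= => ->.
have pn' : 0 < n - p < n by lia.
have [i ei e] := subdiv_pt_inner a pn'; exists i; last by right.
by have := edge_pt_bwd n a p; rewrite va /= => ->.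
Qed.

Lemma edge_pt_inl (G : sgraph) n (u v w : G) p : 0 < n -> sedge u v ->
  p <= n -> edge_pt n u v p = inl w -> p = 0 /\ w = u \/ p = n /\ w = v.
Proof.
move=> n0 uv pn; have [->|p0] := posnP p.
  by rewrite edge_pt0 // => -[->]; left.
have [->|pn'] := eqVneq p n; first by rewrite edge_ptn // => -[->]; right.
have pn0 : 0 < p < n by lia.
by have [a [i ->]] := edge_pt_inner uv pn0.
Qed.

(** An interior point lies on a single edge path and has two descriptions only because this path can
    be read from both ends. *)
Lemma edge_pt_inj (G : sgraph) n (u v u' v' : G) p p' :
  sedge u v -> sedge u' v' -> 0 < p < n -> p' <= n ->
  edge_pt n u v p = edge_pt n u' v' p' ->
  [/\ u' = u, v' = v & p' = p] \/ [/\ u' = v, v' = u & p' = n - p].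
Proof.
move=> uv uv' pn pn' e.
have n0 : 0 < n by lia.
have [a [i ea va]] := edge_pt_inner uv pn.
have pn'' : 0 < p' < n.
  move: e; rewrite ea; have [->|p0] := posnP p'; first by rewrite edge_pt0.
  have [->|np] := eqVneq p' n; first by rewrite edge_ptn.
  by move=> _; lia.
have [a' [i' ea' va']] := edge_pt_inner uv' pn''.
move: e; rewrite ea ea' => -[ea1 ei1]; move: va va'; rewrite -ea1 -ei1.
by case=> -[-> e1] [] [[-> ->] e2]; [left|right|right|left]; split=> //; lia.
Qed.

Lemma subdivision_edge (G : sgraph) n (x y : subdivision G n) : 0 < n ->
  sedge x y -> exists u v p, [/\ sedge u v, p < n, x = edge_pt n u v p &
                                 y = edge_pt n u v p.+1].
Proof.
move=> n0 /existsP[a /existsP[k]]; have kn := ltn_ord k.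
case/orP=> /andP[/eqP-> /eqP->].
  exists (val a).1, (val a).2, k; split; rewrite ?edge_pt_fwd //.
  exact: edge_of_oriented.
exists (val a).2, (val a).1, (n - k.+1).
have uv := edge_of_oriented a.
split; rewrite ?edge_pt_bwd ?subKn //; first by rewrite sedge_sym.
- lia.
- by congr subdiv_pt; lia.
Qed.

Lemma edge_pt_adj (G : sgraph) n (u v : G) p : sedge u v -> p < n ->
  @sedge (subdivision G n) (edge_pt n u v p) (edge_pt n u v p.+1).
Proof.
move=> /orientation[a [] va] pn; apply/existsP; exists a; apply/existsP.
  exists (Ordinal pn); have := edge_pt_fwd n a; rewrite va /= => E.
  by rewrite !E !eqxx.
have pn' : n - p.+1 < n by lia.
exists (Ordinal pn'); have := edge_pt_bwd n a; rewrite va /= => E.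
by rewrite !E (_ : n - p = (n - p.+1).+1) ?eqxx ?orbT //; lia.
Qed.

(** * Short walks in a subdivision *)

Lemma walk0 (H : sgraph) (x y : H) : walk 0 x y = (x == y).
Proof.
apply/existsP/idP=> [[p]|/eqP<-]; first by rewrite tuple0.
by exists [tuple]; rewrite /= eqxx.
Qed.

Lemma walkSr (H : sgraph) k (x z : H) : walk k.+1 x z ->
  exists2 y, walk k x y & sedge y z.
Proof.
case/existsP=> p; case/lastP E: (val p) => [|s w].
  by have := size_tuple p; rewrite E.
rewrite rcons_path last_rcons => /andP[/andP[xs sw] /eqP <-].
exists (last x s) => //; apply/existsP.
have sz : size s == k by have := size_tuple p; rewrite E size_rcons => -[->].
by exists (Tuple sz); rewrite /= xs eqxx.
Qed.

Lemma walkS (H : sgraph) k (x y z : H) : walk k x y -> sedge y z ->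
  walk k.+1 x z.
Proof.
case/existsP=> p /andP[xp /eqP ly] yz; apply/existsP.
have sz : size (rcons p z) == k.+1 by rewrite size_rcons size_tuple.
by exists (Tuple sz); rewrite /= rcons_path last_rcons xp ly yz eqxx.
Qed.

Lemma walk_edge_pt (G : sgraph) n (u v v' : G) p q : sedge u v ->
  sedge u v' -> p <= n -> q <= n -> 0 < n ->
  @walk (subdivision G n) (p + q) (edge_pt n u v p) (edge_pt n u v' q).
Proof.
move=> uv uv' pn qn n0; elim: q qn => [|q IH] qn; last first.
  by rewrite addnS; apply: walkS (IH (ltnW qn)) (edge_pt_adj _ _).
rewrite edge_pt0 // addn0 -(edge_pt0 n0 uv) walk_sym.
elim: p pn => [|p IH] pn; first by rewrite walk0.
exact: walkS (IH (ltnW pn)) (edge_pt_adj _ _).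
Qed.

(** A walk shorter than [n] meets at most one vertex of [G]. The alternatives for the positions
    stand for a route along one edge path and a route through [u]. Equality is listed separately
    because an isolated vertex lies on no edge path. *)
Lemma short_walk (G : sgraph) n k (x y : subdivision G n) : k < n ->
  walk k x y ->
  x = y \/ exists u v v' p q,
    [/\ sedge u v, sedge u v' & [/\ p <= n, q <= n, x = edge_pt n u v p &
        y = edge_pt n u v' q]] /\
    (v = v' /\ p <= q + k /\ q <= p + k \/ p + q <= k).
Proof.
elim: k y => [|k IH] y kn.
  by rewrite walk0 => /eqP->; left.
have n0 : 0 < n by lia.
case/walkSr=> z wz zy; have IHz := IH z (ltnW kn) wz; right.
have [u [v [p [uv pn ez ey]]]] := subdivision_edge n0 zy.
case: IHz => [->|[u1 [v1 [v2 [p1 [p2 [[uv1 uv2 [pn1 pn2 ex ez2]] near]]]]]]].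
  exists u, v, v, p, p.+1; split; last by left; split=> //; lia.
  by split=> //; split=> //; lia.
have uv' : sedge v u by rewrite sedge_sym.
(* The last step leaves a vertex [w] of [G]. If [w] is the far end of the path of [z], the
   description is re-rooted there; the route through [u1] is then impossible because [n <= k]
   fails. *)
have from_end w w' : y = edge_pt n w w' 1 -> sedge w w' -> z = inl w ->
    (p2 = 0 /\ w = u1 \/ p2 = n /\ w = v2) ->
  exists u v v' p q,
    [/\ sedge u v, sedge u v' & [/\ p <= n, q <= n, x = edge_pt n u v p &
        y = edge_pt n u v' q]] /\
    (v = v' /\ p <= q + k.+1 /\ q <= p + k.+1 \/ p + q <= k.+1).
  move=> yw ww' zw [[e2 ew]|[e2 ew]].
    exists u1, v1, w', p1, 1; split; last by right; lia.
    by rewrite ew in yw ww'; split=> //; split.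
  case: near => [[e12 near]|near]; last by lia.
  exists v2, u1, w', (n - p1), 1; split; last by right; lia.
  rewrite ew in yw ww'; split=> //; first by rewrite sedge_sym.
  by split=> //; [lia|rewrite ex e12 edge_pt_rev].
have [p0|p0] := posnP p.
  apply: (from_end u v); rewrite ?ey ?p0 // ?ez ?p0 ?edge_pt0 //.
  by apply: (edge_pt_inl n0 uv2 pn2); rewrite -ez2 ez p0 edge_pt0.
case: (@edge_pt_inj G n u v u1 v2 p p2) => //; rewrite -?ez ?p0 //.
- case=> eu ev ep; subst u1 v2 p2.
  exists u, v1, v, p1, p.+1; split; first by split.
  by case: near => [[-> near]|near]; [left; split=> //; lia|right; lia].
- case=> eu ev ep; subst u1 v2 p2.
  exists v, v1, u, p1, (n - p.+1); split.
    by split=> //; split=> //; [lia|rewrite ey -edge_pt_rev].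
  by case: near => [[-> near]|near]; [left; split=> //; lia|right; lia].
Qed.

(** * Colourings given by words on the edge paths *)

Definition palette (D r : nat) : pred (nat * nat) :=
  [pred c | (c == (D, 0)) || (c.1 < D) && (0 < c.2 <= r)].

Lemma palette_numbering D r : exists code : nat * nat -> nat,
  (forall c, c \in palette D r -> code c < (r * D).+1) /\
  {in palette D r &, injective code}.
Proof.
exists (fun c => if c.2 is i.+1 then (c.1 * r + i).+1 else 0); split.
  case=> x [|i] //=; rewrite !inE /= => /orP[/eqP//|/andP[xD ir]].
  have : x.+1 * r <= D * r by rewrite leq_mul2r xD orbT.
  by rewrite mulSn mulnC [D * r]mulnC; lia.
case=> [x [|i]] [y [|j]]; rewrite !inE /= ?andbF ?orbF.
- by move=> /eqP[->] /eqP[->].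
- by move=> _ _.
- by move=> _ _.
case/orP=> [/eqP//|/andP[_ ir]]; case/orP=> [/eqP//|/andP[_ jr]] [e].
have r0 : 0 < r by lia.
have exy : x = y.
  move: (congr1 (divn^~ r) e).
  by rewrite !divnMDl // !divn_small ?addn0 //; lia.
by move: e; rewrite exy => /addnI->.
Qed.

(* st x k is the colour at distance k from a vertex along its dart labelled x.
   The word w, read from that vertex along the dart labelled l, agrees with st
   up to distance r and then avoids the colours of the other darts that are
   within distance 2r. *)
Definition fits (D r : nat) (st : nat -> nat -> nat * nat) (l : nat)
    (w : nat -> nat * nat) : Prop :=
  (forall p, 0 < p <= r -> w p = st l p) /\
  (forall p x q, r < p -> x < D -> x <> l -> 0 < q -> p + q <= r.*2 ->
     w p <> st x q).

Definition edge_word (D r n : nat) (cu : nat * nat) (su : nat -> nat -> nat * nat)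
    (lu : nat) (cv : nat * nat) (sv : nat -> nat -> nat * nat) (lv : nat)
    (w : nat -> nat * nat) : Prop :=
  [/\ w 0 = cu /\ w n = cv,
      forall p, p <= n -> w p \in palette D r,
      forall p q, p < q <= n -> q <= p + r.*2 -> w p <> w q,
      fits D r su lu w &
      fits D r sv lv (fun p => w (n - p))].

Lemma edge_word_rev D r n cu su lu cv sv lv w : r.*2 < n ->
  edge_word D r n cu su lu cv sv lv w ->
  edge_word D r n cv sv lv cu su lu (fun p => w (n - p)).
Proof.
move=> rn [[w0 wn] wp win [fu1 fu2] fv]; split=> //.
- by rewrite subn0 subnn.
- by move=> p pn; apply: wp; lia.
- by move=> p q pq qp /esym; apply: win; lia.
- split=> [p pr|p x q rp xD xl q0 pq]; rewrite subKn; try lia; first exact: fu1.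
  exact: fu2.
Qed.

(** A window of length [2r + 1] across the seam consists of the first [2r + 1] letters, cyclically
    shifted. The letters within distance [2r] of either end do not change, so both [fits] conditions
    persist. *)
Lemma edge_word_stretch D r n cu su lu cv sv lv k w : r.*2 < n ->
  edge_word D r n cu su lu cv sv lv w ->
  exists w', edge_word D r (n + k * (r.*2).+1) cu su lu cv sv lv w'.
Proof.
move=> rn; elim: k => [|k IH] ew; first by exists w; rewrite addn0.
have {IH ew w} [w] := IH ew; rewrite mulSn addnCA [_ + (n + _)]addnC.
move: (k * _) => j; move: (n + j) (leq_trans rn (leq_addr j n)) => {}n {}rn.
case=> -[w0 wn] wp win [fu1 fu2] [fv1 fv2].
have back p : p <= r.*2 -> n + (r.*2).+1 - p - (r.*2).+1 = n - p by lia.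
exists (fun p => if p <= r.*2 then w p else w (p - (r.*2).+1)); split=> /=.
- by rewrite leqNgt (_ : _ < _) /= ?addnK //; lia.
- by move=> p pn; case: ifP => h; apply: wp; lia.
- move=> p q pq qp; case: ifP => h; case: ifP => h'; try lia.
  + by apply: win; lia.
  + by apply/nesym; apply: win; lia.
  + by apply: win; lia.
- split=> [p pr|p x q rp xD xl q0 pq]; rewrite ifT; try lia; first exact: fu1.
  exact: fu2.
- split=> [p pr|p x q rp xD xl q0 pq]; rewrite ifF; try lia; rewrite back; try lia.
    exact: fv1.
  exact: fv2.
Qed.

(** Points within distance [2r] on different paths at a common vertex cannot both be more than [r]
    away from it. So one of them has a star colour, and the other is either in the star too or kept
    apart by [fits]. *)
Lemma frac_power_colorable (G : sgraph) (D r n : nat) (lbl : G -> G -> nat)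
    (cen : G -> nat * nat) (st : G -> nat -> nat -> nat * nat) :
  r.*2 < n ->
  (forall u v, sedge u v -> lbl u v < D) ->
  (forall u v v', sedge u v -> sedge u v' -> lbl u v = lbl u v' -> v = v') ->
  (forall u, cen u \in palette D r) ->
  (forall u x y p q, x < D -> y < D -> x <> y -> 0 < p <= r -> 0 < q <= r ->
     st u x p <> st u y q) ->
  (forall u v, sedge u v -> exists w,
     edge_word D r n (cen u) (st u) (lbl u v) (cen v) (st v) (lbl v u) w) ->
  colorable (frac_power G r.*2 n) (r * D).+1.
Proof.
move=> rn lblD lbl_inj cenP st_inj words; have n0 : 0 < n by lia.
have /fin_all_exists[W ewW] : forall a : oriented_edge G, exists w,
    edge_word D r n (cen (val a).1) (st (val a).1) (lbl (val a).1 (val a).2)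
      (cen (val a).2) (st (val a).2) (lbl (val a).2 (val a).1) w.
  by move=> a; apply/words/edge_of_oriented.
pose col (x : frac_power G r.*2 n) : nat * nat := match x with
  | inl u => cen u | inr (a, i) => W a i.+1 end.
have colW a p : p <= n -> col (subdiv_pt n a p) = W a p.
  move=> pn; have [[w0 wn] _ _ _ _] := ewW a.
  have [->|p0] := posnP p; first by rewrite w0.
  have [->|np] := eqVneq p n; first by rewrite subdiv_pt_end // wn.
  have p0n : 0 < p < n by lia.
  by have [i -> ->] := subdiv_pt_inner a p0n.
have word u v : sedge u v -> exists2 w,
    forall p, p <= n -> col (edge_pt n u v p) = w p &
    edge_word D r n (cen u) (st u) (lbl u v) (cen v) (st v) (lbl v u) w.
  case/orientation=> a [] va.
    exists (W a) => [p pn|]; last by have := ewW a; rewrite va.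
    by have := edge_pt_fwd n a p; rewrite va => /= ->; apply: colW.
  exists (fun p => W a (n - p)) => [p pn|].
    by have := edge_pt_bwd n a p; rewrite va => /= ->; apply: colW; lia.
  by apply: edge_word_rev => //; have := ewW a; rewrite va.
have colP x : col x \in palette D r.
  case: x => [u|[a i]] /=; first exact: cenP.
  by have [_ wp _ _ _] := ewW a; apply: wp; have := ltn_ord i; lia.
have same u v p q : sedge u v -> p <= n -> q <= n -> p <= q + r.*2 -> q <= p + r.*2 ->
    edge_pt n u v p <> edge_pt n u v q ->
    col (edge_pt n u v p) <> col (edge_pt n u v q).
  move=> uv pn qn pq qp neq; have [w colw [_ _ win _ _]] := word u v uv.
  rewrite !colw //; case: (ltngtP p q) => [lt|lt|e].
  - by apply: win; lia.
  - by apply/nesym; apply: win; lia.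
  - by rewrite e in neq.
have far u v v' p q : sedge u v -> sedge u v' -> v <> v' -> r < p ->
    0 < q -> p <= n -> q <= n -> p + q <= r.*2 ->
    col (edge_pt n u v p) <> col (edge_pt n u v' q).
  move=> uv uv' nv rp q0 pn qn pq.
  have [w colw [_ _ _ [_ fu] _]] := word u v uv.
  have [w' colw' [_ _ _ [fu' _] _]] := word u v' uv'.
  rewrite colw // colw' // (fu' q); last by lia.
  apply: fu => //; first exact: lblD.
  by move=> /esym/lbl_inj e; apply: nv; apply: e.
have proper x y : @sedge (frac_power G r.*2 n) x y -> col x <> col y.
  case/and3P=> /eqP nxy cxy dxy.
  have [|k km wk] := @dist_leP (subdivision G n) r.*2 x y _.
    by rewrite cxy dxy.
  case: (short_walk (leq_ltn_trans km rn) wk) => // -[u [v [v' [p [q]]]]].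
  case=> -[uv uv' [pn qn ex ey]] near; rewrite ex ey in nxy *.
  case: near => [[ev near]|near].
    by subst v'; apply: same => //; lia.
  have [ev|/eqP nv] := eqVneq v v'; first by subst v'; apply: same => //; lia.
  (* The common vertex lies on both paths, so the comparison takes place on the path of the other
     point. *)
  have [p0|p0] := posnP p.
    by move: nxy; rewrite p0 (edge_pt0 n0 uv) -(edge_pt0 n0 uv'); apply: same => //; lia.
  have [q0|q0] := posnP q.
    by move: nxy; rewrite q0 (edge_pt0 n0 uv') -(edge_pt0 n0 uv); apply: same => //; lia.
  have [rp|pr] := ltnP r p; first by apply: far => //; lia.
  have [rq|qr] := ltnP r q; first by apply/nesym; apply: far => //; [exact: nesym|lia].
  have [w colw [_ _ _ [fu _] _]] := word u v uv.
  have [w' colw' [_ _ _ [fu' _] _]] := word u v' uv'.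
  rewrite colw // colw' // fu ?fu'; try lia.
  apply: st_inj; rewrite ?lblD ?p0 ?q0 //.
  by move=> /lbl_inj e; apply: nv; apply: e.
have [code [codeD code_inj]] := palette_numbering D r.
apply/existsP; exists [ffun x => Ordinal (codeD _ (colP x))].
apply/forallP=> x; apply/forallP=> y; apply/implyP=> /proper xy; rewrite !ffunE.
by apply: contra_notN xy => /eqP[] /code_inj; apply.
Qed.

(** * The lower bound by cliques *)

Lemma clique_le_chromatic (H : sgraph) : clique_number H <= chromatic_number H.
Proof.
rewrite /chromatic_number; case: ex_minnP => k /existsP[f /forallP fP] _.
apply/bigmax_leqP => S /forallP cS; rewrite -[k]card_ord.
apply: (@leq_card_in _ _ f); move=> x y xS yS fxy; apply/eqP/negPn/negP=> nxy.
have := cS x; rewrite xS /= => /forallP/(_ y); rewrite yS nxy /= => exy.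
by have := fP x => /forallP/(_ y); rewrite exy fxy eqxx.
Qed.

Lemma ball_clique (G : sgraph) (r n : nat) (u : G) : r.*2 < n ->
  (r * degree u).+1 <= clique_number (frac_power G r.*2 n).
Proof.
move=> rn; have n0 : 0 < n by lia.
pose N := {v : G | sedge u v}.
pose f (c : option ('I_r * N)) : frac_power G r.*2 n :=
  if c is Some (i, v) then edge_pt n u (val v) i.+1 else inl u.
have f_inj : injective f.
  have fS i v : inl u <> f (Some (i, v)).
    move=> /esym e; have uv := valP v; have ri := ltn_ord i.
    have := edge_pt_inl n0 uv (_ : i.+1 <= n) e.
    case; first by lia.
      by case.
    by case=> e2; lia.
  case=> [[i v]|] [[j v']|] // e; last 2 first.
  - by case: (fS i v).
  - by case: (fS j v').
  have uv := valP v; have uv' := valP v'; have ri := ltn_ord i; have rj := ltn_ord j.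
  have ni : 0 < i.+1 < n by lia.
  have nj : j.+1 <= n by lia.
  case: (edge_pt_inj uv uv' ni nj e) => -[_ ev eij]; last by lia.
  by case: eij => /val_inj->; rewrite (val_inj ev).
have <- : #|f @: [set: option ('I_r * N)]| = (r * degree u).+1.
  rewrite card_imset // cardsT card_option card_prod card_ord card_sig.
  by congr (_ * _).+1; rewrite /degree cardsE.
have close c d : connect (@sedge (subdivision G n)) (f c) (f d) &&
    (@dist (subdivision G n) (f c) (f d) <= r.*2).
  have fE e : f e = inl u \/ exists v p, [/\ sedge u v, p <= r & f e = edge_pt n u v p].
    case: e => [[i v]|]; last by left.
    by right; exists (val v), i.+1; split; rewrite ?ltn_ord //; apply: (valP v).
  case: (fE c) => [->|[v [p [uv pr ->]]]]; case: (fE d) => [->|[v' [q [uv' qr ->]]]];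
    apply/dist_leP.
  - by exists 0; rewrite ?walk0.
  - exists (0 + q); first by lia.
    by rewrite -(edge_pt0 n0 uv'); apply: walk_edge_pt => //; lia.
  - exists (p + 0); first by lia.
    by rewrite -(edge_pt0 n0 uv); apply: walk_edge_pt => //; lia.
  - by exists (p + q); [lia|apply: walk_edge_pt => //; lia].
apply: (@leq_bigmax_cond _ (@clique (frac_power G r.*2 n)) (fun S => #|S|)).
apply/forallP=> x; apply/implyP=> /imsetP[c _ ->].
apply/forallP=> y; apply/implyP=> /imsetP[d _ ->].
apply/implyP=> nxy; apply/and3P; split=> //.
  by have /andP[] := close c d.
by have /andP[] := close c d.
Qed.

(** * Words on the edge paths *)

Lemma pair_neq (a b c d : nat) : a <> c \/ b <> d -> (a, b) <> (c, d).
Proof. by case=> ne [e e']; apply: ne. Qed.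

Lemma in_palette D r x i :
  x = D /\ i = 0 \/ x < D /\ 0 < i <= r -> (x, i) \in palette D r.
Proof. by rewrite inE xpair_eqE /=; lia. Qed.

Definition proper_star (D r : nat) (cu : nat * nat) (su : nat -> nat -> nat * nat)
    (lu : nat) : Prop :=
  [/\ cu \in palette D r,
      forall k, 0 < k <= r -> su lu k \in palette D r,
      forall k, 0 < k <= r -> cu <> su lu k &
      forall k k', 0 < k < k' -> k' <= r -> su lu k <> su lu k'].

(* The part of the conditions on the middle word [mid] that concerns the star
   at the end from which [mid] is read. *)
Definition mid_fits (D r s : nat) (cu : nat * nat) (su : nat -> nat -> nat * nat)
    (lu : nat) (mid : nat -> nat * nat) : Prop :=
  [/\ forall i, 0 < i <= s -> i <= r -> cu <> mid i,
      forall k i, 0 < k <= r -> 0 < i <= s -> i <= r + k -> su lu k <> mid i &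
      forall i x q, 0 < i <= s -> x < D -> x <> lu -> 0 < q -> i + q <= r ->
        mid i <> su x q].

(* What the two stars require of each other, independently of [mid]. *)
Definition stars_fit (D r s : nat) (cu : nat * nat) (su : nat -> nat -> nat * nat)
    (lu : nat) (sv : nat -> nat -> nat * nat) (lv : nat) : Prop :=
  (forall k, s < k <= r -> cu <> sv lv k) /\
  (forall k x q, x < D -> x <> lu -> 0 < q -> q + s < k -> k <= r ->
     sv lv k <> su x q).

(** The word has five pieces: [cu], the star letters of the first end, [mid], the star letters of
    the second end read backwards, and [cv]. Letter [i] of [mid] has index [s.+1 - i] from the other
    end. Star letters at distances [k] and [k'] from their ends are at most [2r] apart exactly when
    [s < k + k']. *)
Lemma assemble_word D r s cu su lu mid sv lv cv : s <= r.*2 ->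
  proper_star D r cu su lu -> proper_star D r cv sv lv ->
  stars_fit D r s cu su lu sv lv -> stars_fit D r s cv sv lv su lu ->
  (forall k k', 0 < k <= r -> 0 < k' <= r -> s < k + k' -> su lu k <> sv lv k') ->
  (forall i, 0 < i <= s -> mid i \in palette D r) ->
  (forall i i', 0 < i < i' -> i' <= s -> mid i <> mid i') ->
  mid_fits D r s cu su lu mid -> mid_fits D r s cv sv lv (fun i => mid (s.+1 - i)) ->
  exists w, edge_word D r (r.*2 + s).+1 cu su lu cv sv lv w.
Proof.
move=> sr [cuP suP cusu suu] [cvP svP cvsv svv] [cusv suv] [cvsu svu] sus midP mm
  [mu1 mu2 mu3] [mv1 mv2 mv3].
pose w p := if p == 0 then cu else if p <= r then su lu p
  else if p <= r + s then mid (p - r)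
  else if p <= r.*2 + s then sv lv ((r.*2 + s).+1 - p) else cv.
have {}mv1 i : 0 < i <= s -> s < i + r -> mid i <> cv.
  by move=> h h'; have := mv1 (s.+1 - i); rewrite subKn; [move=> H /esym; apply: H; lia|lia].
have {}mv2 k i : 0 < k <= r -> 0 < i <= s -> s < i + r + k -> mid i <> sv lv k.
  by move=> hk h h'; have := mv2 k (s.+1 - i); rewrite subKn; [move=> H /esym; apply: H; lia|lia].
have {}mv3 i x q : 0 < i <= s -> x < D -> x <> lv -> 0 < q -> s + q < i + r ->
    mid i <> sv x q.
  by move=> h xD xl q0 h'; have := mv3 (s.+1 - i) x q; rewrite subKn; [apply=> //; lia|lia].
have w0 : w 0 = cu by [].
have w1 p : 0 < p <= r -> w p = su lu p.
  move=> h; rewrite /w; repeat (case: ifP => ?; try lia); by [].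
have w2 p : r < p <= r + s -> w p = mid (p - r).
  move=> h; rewrite /w; repeat (case: ifP => ?; try lia); by [].
have w3 p : r + s < p <= r.*2 + s -> w p = sv lv ((r.*2 + s).+1 - p).
  move=> h; rewrite /w; repeat (case: ifP => ?; try lia); by [].
have w4 p : r.*2 + s < p -> w p = cv.
  move=> h; rewrite /w; repeat (case: ifP => ?; try lia); by [].
have piece p : [\/ p = 0 /\ w p = cu, 0 < p <= r /\ w p = su lu p |
    [\/ r < p <= r + s /\ w p = mid (p - r),
        r + s < p <= r.*2 + s /\ w p = sv lv ((r.*2 + s).+1 - p) |
        r.*2 + s < p /\ w p = cv]].
  have [->|p0] := posnP p; first by constructor 1.
  case: (leqP p r) => h1; first by constructor 2; rewrite w1 ?p0.
  constructor 3; case: (leqP p (r + s)) => h2; first by constructor 1; rewrite w2 ?h1.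
  case: (leqP p (r.*2 + s)) => h3; first by constructor 2; rewrite w3 ?h2.
  by constructor 3; rewrite w4.
exists w; split.
- by rewrite w0 w4.
- move=> p pn; case: (piece p) => [[_ ->]|[h ->]|[[h ->]|[h ->]|[_ ->]]] //.
  + exact: suP.
  + by apply: midP; lia.
  + by apply: svP; lia.
- move=> p q pq qp.
  case: (piece p) => [[h ->]|[h ->]|[[h ->]|[h ->]|[h _]]]; last by lia.
  + case: (piece q) => [[h' ->]|[h' ->]|[[h' ->]|[h' ->]|[h' ->]]]; try lia.
    * exact: cusu.
    * by apply: mu1; lia.
    * by apply: cusv; lia.
  + case: (piece q) => [[h' ->]|[h' ->]|[[h' ->]|[h' ->]|[h' ->]]]; try lia.
    * by apply: suu; lia.
    * by apply: mu2; lia.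
    * by apply: sus; lia.
    * by apply/nesym/cvsu; lia.
  + case: (piece q) => [[h' ->]|[h' ->]|[[h' ->]|[h' ->]|[h' ->]]]; try lia.
    * by apply: mm; lia.
    * by apply: mv2; lia.
    * by apply: mv1; lia.
  + case: (piece q) => [[h' ->]|[h' ->]|[[h' ->]|[h' ->]|[h' ->]]]; try lia.
    * by apply/nesym/svv; lia.
    * by apply/nesym/cvsv; lia.
- split=> // p x q rp xD xl q0 pq.
  case: (piece p) => [[h ->]|[h ->]|[[h ->]|[h ->]|[h _]]]; try lia.
  + by apply: mu3 => //; lia.
  + by apply: suv => //; lia.
- split=> [p h|p x q rp xD xl q0 pq]; first by rewrite w3 ?subKn //; lia.
  case: (piece ((r.*2 + s).+1 - p)) => [[h ->]|[h ->]|[[h ->]|[h ->]|[h _]]]; try lia.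
  + by apply: svu => //; lia.
  + by apply: mv3 => //; lia.
Qed.

Ltac split_ifs := repeat match goal with
  | |- context [if ?b then _ else _] =>
      lazymatch b with context [if _ then _ else _] => fail | _ => idtac end;
      let E := fresh "E" in case E: b; try (exfalso; lia) end.

Ltac color_arith := split_ifs;
  first [apply: pair_neq; lia | apply: in_palette; lia | congr (_, _); lia | by [] ].

Lemma word_four_blocks D r s a b c d : s <= r.*2 ->
  a < D -> b < D -> c < D -> d < D ->
  a <> b -> a <> c -> a <> d -> b <> c -> b <> d -> c <> d ->
  exists w, edge_word D r (r.*2 + s).+1 (D, 0) pair a (D, 0) pair b w.
Proof.
move=> sr aD bD cD dD ab ac ad bc bd cd.
(* The letter at distance [r + i] from the first end has its copy in that star at distance
   [r + 1 - i]; the sum [2r + 1] is just out of range. The second half does the same from the other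
   end. *)
pose mid i := if i <= uphalf s then (c, r.+1 - i) else (d, i + r - s).
have pair_proper l : l < D -> proper_star D r (D, 0) pair l.
  by move=> lD; split=> *; color_arith.
by apply: (assemble_word (mid := mid)); rewrite ?/mid; try exact: pair_proper;
  rewrite // => *; try split=> *; color_arith.
Qed.

(** The levels from [r - s + 1] to [r] are reversed. Lower ones stay in place because star colours
    of the two ends can clash only at distances [q] and [k] with [q + s < k <= r], where [q] is
    below the reversed levels. *)
Definition top_reversed (r s : nat) (F : nat -> bool) (x k : nat) : nat * nat :=
  if F x && (r - s < k) then (x, (r.*2).+1 - s - k) else (x, k).

Lemma word_short r s a b c Fu Fv : s <= r ->
  a < 3 -> b < 3 -> c < 3 -> a <> b -> a <> c -> b <> c -> Fu c = ~~ Fv c ->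
  exists w, edge_word 3 r (r.*2 + s).+1 (3, 0) (top_reversed r s Fu) a
                                      (3, 0) (top_reversed r s Fv) b w.
Proof.
move=> sr a3 b3 c3 ab ac bc Fc.
(* Distances to a letter and to its copy in the first star add up to [2r + 1]. Since the orders are
   opposite, the same word read backwards has this property for the second star. *)
pose mid i := top_reversed r s Fu c (r.+1 - i).
have proper F l : l < 3 -> proper_star 3 r (3, 0) (top_reversed r s F) l.
  by rewrite /top_reversed => l3; split=> *; color_arith.
apply: (assemble_word (mid := mid)); try exact: proper; rewrite ?/mid /top_reversed.
- by lia.
- by split=> *; color_arith.
- by split=> *; color_arith.
- by move=> *; color_arith.
- by move=> *; color_arith.
- by move=> *; color_arith.
- split=> [*|*|i x q h x3 xa q0 iq]; try color_arith.
  by have [->|->] : x = c \/ x = b by [lia]; color_arith.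
- rewrite Fc; split=> [*|*|i x q h x3 xa q0 iq]; try color_arith.
  by have [->|->] : x = c \/ x = a by [lia]; color_arith.
Qed.

(* A star with blocks x < 3 in increasing or decreasing order, according to F.
   If sw < 3, the sequence formed by the centre (3, 0) and the block sw has been
   reversed; sw = 3 means that there is no such block. *)
Definition centre (r sw : nat) : nat * nat := if sw < 3 then (sw, r) else (3, 0).

Definition flipped (r : nat) (F : nat -> bool) (sw x k : nat) : nat * nat :=
  if x == sw then if k < r then (x, r - k) else (3, 0)
  else if F x then (x, r.+1 - k) else (x, k).

Lemma flipped_proper r F sw l : 0 < r -> l < 3 -> 
  proper_star 3 r (centre r sw) (flipped r F sw) l.
Proof. by move=> r0 l3; rewrite /centre /flipped; split=> *; color_arith. Qed.

(** Both conditions are vacuous, as a middle longer than [r] keeps the two stars apart. *)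
Lemma flipped_stars_fit r s Fu Fv a b l l' : r < s -> 
  stars_fit 3 r s (centre r a) (flipped r Fu a) l (flipped r Fv b) l'.
Proof. by split=> *; lia. Qed.

(** A colour of the common block [x] is at distances with sum [r + 1] from the two ends, so its two
    occurrences are [r + s > 2r] apart. The middle takes the block [y] as ordered at the first end,
    then [z] as ordered at the second, each with the farthest colours next to its star. *)
Lemma word_equal_labels_ordered r s x y z Fu Fv a b : r < s -> s <= r.*2 ->
  x < 3 -> y < 3 -> z < 3 -> x <> y -> x <> z -> y <> z -> Fu x = ~~ Fv x ->
  [\/ a = 3 /\ b = 3, a = y /\ b = 3, a = y /\ b = y | a = z /\ b = y] ->
  exists w, edge_word 3 r (r.*2 + s).+1 (centre r a) (flipped r Fu a) x
                                      (centre r b) (flipped r Fv b) x w.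
Proof.
move=> rs sr x3 y3 z3 xy xz yz Fx ab.
(* The centre colour (3, 0), which sits at distance r in both stars, is needed
   in the middle if the two reversed sequences are different. *)
pose mid i := if i <= uphalf s then
    if (i == uphalf s) && (b == y) && (a == z) then (3, 0)
    else flipped r Fu a y (r.+1 - i)
  else flipped r Fv b z (i + r - s).
have exy : (x == y) = false by lia.
have exz : (x == z) = false by lia.
have eyz : (y == z) = false by lia.
have ezy : (z == y) = false by lia.
have ex3 : (x == 3) = false by lia.
have ey3 : (y == 3) = false by lia.
have ez3 : (z == 3) = false by lia.
have third t : t < 3 -> t <> x -> t = y \/ t = z by lia.
apply: (assemble_word (mid := mid)); try apply: flipped_stars_fit;
  try apply: flipped_proper; try lia.
all: rewrite /mid /flipped /centre.
all: case: ab => -[-> ->];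
  rewrite ?(exy, exz, eyz, ezy, ex3, ey3, ez3, eqxx, andbT, andbF, Fx) /=;
  clear mid exy exz eyz ezy ex3 ey3 ez3 Fx.
all: try (by move=> *; color_arith).
all: split=> [*|*|i t q h t3 tx q0 iq]; try (by color_arith).
all: have [->|->] := third t t3 tx; clear third; color_arith.
Qed.

(** Exchanging the ends and exchanging [y] with [z] reduce the nine pairs [(a, b)] to the four
    ordered cases. *)
Lemma word_equal_labels r s x Fu Fv a b : r < s -> s <= r.*2 -> x < 3 ->
  a <= 3 -> b <= 3 -> a <> x -> b <> x -> Fu x = ~~ Fv x ->
  exists w, edge_word 3 r (r.*2 + s).+1 (centre r a) (flipped r Fu a) x
                                      (centre r b) (flipped r Fv b) x w.
Proof.
move=> rs sr x3 a3 b3 ax bx Fx.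
have [y [z [y3 z3 [xy xz yz]]]] : exists y z,
    [/\ y < 3, z < 3 & [/\ x <> y, x <> z & y <> z]].
  exists (x == 0), (3 - x - (x == 0)).
  by case: x x3 {ax bx Fx} => [|[|[|//]]].
have main Gu Gv c d y' z' : Gu x = ~~ Gv x -> y' < 3 -> z' < 3 -> x <> y' -> x <> z' ->
    y' <> z' -> [\/ c = 3 /\ d = 3, c = y' /\ d = 3, c = y' /\ d = y' | c = z' /\ d = y'] ->
    exists w, edge_word 3 r (r.*2 + s).+1 (centre r c) (flipped r Gu c) x
                                        (centre r d) (flipped r Gv d) x w.
  by move=> Gx y3' z3' xy' xz' yz'; apply: (word_equal_labels_ordered (z := z')).
have rev Gu Gv c d : (exists w, edge_word 3 r (r.*2 + s).+1
      (centre r c) (flipped r Gu c) x (centre r d) (flipped r Gv d) x w) ->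
    exists w, edge_word 3 r (r.*2 + s).+1 (centre r d) (flipped r Gv d) x
                                        (centre r c) (flipped r Gu c) x w.
  case=> w ew; exists (fun p => w ((r.*2 + s).+1 - p)).
  by apply: edge_word_rev => //; lia.
have [a_3|[ay|az]] : a = 3 \/ a = y \/ a = z by lia.
- have [b_3|[by_|bz]] : b = 3 \/ b = y \/ b = z by lia.
  + by apply: (main _ _ _ _ y z) => //; constructor 1.
  + by apply: rev; apply: (main _ _ _ _ y z); rewrite ?Fx ?negbK //; constructor 2.
  + by apply: rev; apply: (main _ _ _ _ z y); rewrite ?Fx ?negbK //;
      [exact: nesym|constructor 2].
- have [b_3|[by_|bz]] : b = 3 \/ b = y \/ b = z by lia.
  + by apply: (main _ _ _ _ y z) => //; constructor 2.
  + by apply: (main _ _ _ _ y z) => //; constructor 3.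
  + by apply: (main _ _ _ _ z y) => //; [exact: nesym|constructor 4].
- have [b_3|[by_|bz]] : b = 3 \/ b = y \/ b = z by lia.
  + by apply: (main _ _ _ _ z y) => //; [exact: nesym|constructor 2].
  + by apply: (main _ _ _ _ y z) => //; constructor 4.
  + by apply: (main _ _ _ _ z y) => //; [exact: nesym|constructor 3].
Qed.

(* Of the 2r + s inner letters, s - r are repetitions: half of them are colours
   of the block a, half of the block b, which are near one end and, by the
   reversal, far from the other. *)
Lemma word_distinct_labels r s a b c Fu Fv : r < s -> s <= r.*2 ->
  a < 3 -> b < 3 -> c < 3 -> a <> b -> a <> c -> b <> c ->
  Fv a = false -> Fv b = false -> Fu b = true -> Fu c = ~~ Fv c ->
  exists w, edge_word 3 r (r.*2 + s).+1 (centre r a) (flipped r Fu a) a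
                                      (centre r 3) (flipped r Fv 3) b w.
Proof.
move=> rs sr a3 b3 c3 ab ac bc Fva Fvb Fub Fc.
(* For [i <= h] the letter [(b, i)] is [r + s + 1 - 2i] away from its copy at the second end, which
   exceeds [2r] because [2h <= s - r]. The piece from the block [a] is one letter longer if [s - r]
   is odd; including the centre in the reversal gains this place. *)
have [h hs] : exists h, h.*2 <= s - r <= (h.*2).+1 by exists (s - r)./2; lia.
pose mid i := if i <= h then (b, i) else
  if i <= h + r then flipped r Fu a c ((h + r).+1 - i) else (a, r - (s - i)).
have third t : t < 3 -> [\/ t = a, t = b | t = c].
  move=> t3; have [->|[->|->]] : t = a \/ t = b \/ t = c by lia.
  - by constructor 1.
  - by constructor 2.
  - by constructor 3.
have eb3 : (b == 3) = false by lia.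
have ea3 : (a == 3) = false by lia.
have ec3 : (c == 3) = false by lia.
have eca : (c == a) = false by lia.
have eba : (b == a) = false by lia.
apply: (assemble_word (mid := mid)); try apply: flipped_stars_fit;
  try apply: flipped_proper; try lia.
all: rewrite /mid /flipped /centre ?(eb3, ea3, ec3, eca, eba, eqxx, Fva, Fvb, Fc) /=.
1-3: clear mid ea3 eb3 ec3 eca eba Fva Fvb Fub Fc third; move=> *; color_arith.
all: split=> [*|*|i t q hi t3 tl q0 iq].
all: try (have [e|e|e] := third t t3; try (by case: tl); rewrite e).
all: rewrite ?(eb3, ea3, ec3, eca, eba, eqxx, Fva, Fvb, Fub, Fc) /=.
all: clear mid ea3 eb3 ec3 eca eba Fva Fvb Fub Fc third; color_arith.
Qed.

(** * The colourings *)

(** By stretching, words are needed only for the length between [2r + 1] and [4r + 1] that is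
    congruent to [n] modulo [2r + 1]. *)
Lemma colorable_of_words (G : sgraph) (D r n : nat) (lbl : G -> G -> nat)
    (cen : G -> nat * nat) (st : G -> nat -> nat -> nat * nat) :
  r.*2 < n ->
  (forall u v, sedge u v -> lbl u v < D) ->
  (forall u v v', sedge u v -> sedge u v' -> lbl u v = lbl u v' -> v = v') ->
  (forall u, cen u \in palette D r) ->
  (forall u x y p q, x < D -> y < D -> x <> y -> 0 < p <= r -> 0 < q <= r ->
     st u x p <> st u y q) ->
  (forall u v, sedge u v -> exists w,
     edge_word D r (r.*2 + (n - (r.*2).+1) %% (r.*2).+1).+1
       (cen u) (st u) (lbl u v) (cen v) (st v) (lbl v u) w) ->
  colorable (frac_power G r.*2 n) (r * D).+1.
Proof.
move=> rn lblD lbl_inj cenP st_inj words.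
apply: (frac_power_colorable (lbl := lbl) (cen := cen) (st := st)) => // u v uv.
have [w ew] := words u v uv; set s := _ %% _ in ew.
have -> : n = (r.*2 + s).+1 + (n - (r.*2).+1) %/ (r.*2).+1 * (r.*2).+1.
  by have := divn_eq (n - (r.*2).+1) (r.*2).+1; rewrite -/s; lia.
by apply: edge_word_stretch ew; lia.
Qed.

Lemma colorable_large_degree (G : sgraph) (r n : nat) : r.*2 < n ->
  3 < max_degree G -> colorable (frac_power G r.*2 n) (r * max_degree G).+1.
Proof.
set D := max_degree G => rn D3.
have [lbl [lblD lbl_inj lblP]] :=
  graph_labelling (fun=> true) (ltnW (ltnW D3)) (leqnn D).
apply: (colorable_of_words (lbl := lbl) (cen := fun=> (D, 0))
  (st := fun=> pair)) => //.
- by move=> u; rewrite inE eqxx.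
- by move=> u x y p q _ _ xy _ _ [].
move=> u v uv; have ab : lbl u v <> lbl v u by apply/eqP; rewrite lblP // eqxx.
have aD := lblD u v uv; have bD : lbl v u < D by apply: lblD; rewrite sedge_sym.
move: (lbl u v) (lbl v u) ab aD bD => a b ab aD bD.
have [c [d [[cD dD cd] [ac ad bc bd]]]] : exists c d,
    [/\ c < D, d < D & c <> d] /\ [/\ a <> c, a <> d, b <> c & b <> d].
  (* The least and the greatest of the labels 0, 1, 2, 3 that differ from [a] and [b]. *)
  exists (if (a != 0) && (b != 0) then 0 else if (a != 1) && (b != 1) then 1 else 2).
  exists (if (a != 3) && (b != 3) then 3 else if (a != 2) && (b != 2) then 2 else 1).
  by split; split; do !case: ifP => ?; lia.
apply: (word_four_blocks (c := c) (d := d)) => //.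
by have := ltn_pmod (n - (r.*2).+1) (ltn0Sn r.*2); lia.
Qed.

Lemma colorable_short_middle (G : sgraph) (r n : nat) : r.*2 < n ->
  max_degree G <= 3 -> (n - (r.*2).+1) %% (r.*2).+1 <= r ->
  colorable (frac_power G r.*2 n) (r * 3).+1.
Proof.
move=> rn G3 sr; have [side cut] := cubic_matching_cut G3.
have [lbl0 [lbl0D lbl0_inj lbl0P]] := graph_labelling side (isT : 1 < 3) G3.
(* The shift separates the equal labels on an edge of the cut and keeps those on an edge inside a
   side distinct. *)
pose lbl u v := (lbl0 u v + side u) %% 3.
have lblD u v : lbl u v < 3 by rewrite ltn_mod.
have lbl_inj u v v' : sedge u v -> sedge u v' -> lbl u v = lbl u v' -> v = v'.
  move=> uv uv' e; apply: (lbl0_inj u) => //; move: e; rewrite /lbl.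
  have := lbl0D u v uv; have := lbl0D u v' uv'; lia.
have lblP u v : sedge u v -> lbl u v <> lbl v u.
  move=> uv; have vu : sedge v u by rewrite sedge_sym.
  have := lbl0P u v uv; have := lbl0D u v uv; have := lbl0D v u vu; rewrite /lbl.
  by case: (side u); case: (side v) => //=; lia.
(* Distinct labels add up to 3, so [x.1] is the label that the edge leaves over. Inside a side the
   neighbour is unique by the choice of the cut; across the cut the left-over label determines the
   label at [x.2], hence the neighbour. *)
pose R (b : bool) (x y : 'I_3 * G) := [&& x.1 == y.1, sedge x.2 y.2,
  (side x.2 == side y.2) == b & x.1 + lbl x.2 y.2 + lbl y.2 x.2 == 3].
have Rsym b : symmetric (R b).
  move=> x y; rewrite /R eq_sym sedge_sym [side _ == _]eq_sym -!addnA [lbl x.2 _ + _]addnC.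
  by case: eqP => //= ->.
have Rirr b : irreflexive (R b) by move=> x; rewrite /R sedge_irrefl andbF.
have Rfun b x y z : R b x y -> R b x z -> y = z.
  case: x y z => [c u] [c1 v] [c2 v'] /and4P[/eqP/= <- uv sv hv].
  case/and4P=> /eqP/= <- uv' sv' hv'.
  congr (_, _); case: b sv sv' => /eqP sv /eqP sv'.
    by apply: (cut u) => //; apply/eqP.
  apply: (lbl0_inj u) => //; move: hv hv'; rewrite /lbl.
  have vu : sedge v u by rewrite sedge_sym.
  have vu' : sedge v' u by rewrite sedge_sym.
  have := lbl0D u v uv; have := lbl0D u v' uv'.
  have := lbl0P u v uv; have := lbl0P u v' uv'; move: sv sv'.
  by case: (side u); case: (side v); case: (side v') => //= _ _ /eqP <- /eqP <-; lia.
have [F [F1 F2]] := two_matchings_colouring (Rsym true) (Rirr true) (Rfun true)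
  (Rsym false) (Rirr false) (Rfun false).
pose s := (n - (r.*2).+1) %% (r.*2).+1.
apply: (colorable_of_words (lbl := lbl) (cen := fun=> (3, 0))
  (st := fun u => top_reversed r s (fun x => F (inord x, u)))) => //.
- by move=> u x y p q _ _ xy _ _; rewrite /top_reversed; do !case: ifP => _; case.
move=> u v uv; have ab := lblP u v uv.
have aD := lblD u v; have bD := lblD v u.
pose c := 3 - lbl u v - lbl v u.
have cD : c < 3 by rewrite /c; lia.
have c_sum : c + lbl u v + lbl v u = 3 by rewrite /c; lia.
apply: (word_short (c := c)) => //; try lia.
suff -> : F (inord c, v) = ~~ F (inord c, u) by rewrite negbK.
have e : R (side u == side v) (inord c, u) (inord c, v).
  by rewrite /R /= uv !eqxx inordK // c_sum eqxx.
by case: (side u == side v) e => [/F1|/F2].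
Qed.

Lemma colorable_long_middle (G : sgraph) (r n : nat) : 0 < r -> r.*2 < n ->
  max_degree G <= 3 -> r < (n - (r.*2).+1) %% (r.*2).+1 ->
  colorable (frac_power G r.*2 n) (r * 3).+1.
Proof.
move=> r0 rn G3 rs; have [side cut] := cubic_matching_cut G3.
have [lbl [lblD lbl_inj lblP]] := graph_labelling side (isT : 1 < 3) G3.
have symE (u v : G) : sedge u v -> sedge v u by rewrite sedge_sym.
pose R1 (x y : 'I_3 * G) := [&& x.1 == y.1, sedge x.2 y.2, side x.2 != side y.2,
   lbl x.2 y.2 == x.1 & lbl y.2 x.2 == x.1].
(* The second alternative ensures that at exactly one end of each matching edge
   the centre may be reversed with the block towards the other end. *)
pose R2 (x y : 'I_3 * G) := [&& sedge x.2 y.2, side x.2 == side y.2 &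
  (x.1 == y.1) && (x.1 + lbl x.2 y.2 + lbl y.2 x.2 == 3) ||
  (x.1 == lbl y.2 x.2 :> nat) && (y.1 == lbl x.2 y.2 :> nat)].
have R1sym : symmetric R1.
  move=> x y; rewrite /R1 eq_sym sedge_sym [side _ == _]eq_sym.
  case: eqP => //= ->; do 2!congr (_ && _); exact: andbC.
have R1irr : irreflexive R1 by move=> x; rewrite /R1 sedge_irrefl andbF.
have R1fun x y z : R1 x y -> R1 x z -> y = z.
  case: x y z => [c u] [c1 v] [c2 v'] /and5P[/eqP/= <- uv _ /eqP hv _].
  case/and5P=> /eqP/= <- uv' _ /eqP hv' _; congr (_, _).
  by apply: (lbl_inj u) => //; rewrite hv.
have R2sym : symmetric R2.
  move=> x y; rewrite /R2 sedge_sym [side _ == _]eq_sym [x.1 == _]eq_sym.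
  do 2!congr (_ && _); congr (_ || _); last exact: andbC.
  by case: eqP => //= ->; rewrite addnAC.
have R2irr : irreflexive R2 by move=> x; rewrite /R2 sedge_irrefl.
have R2fun x y z : R2 x y -> R2 x z -> y = z.
  case: x y z => [c u] [c1 v] [c2 v'] /and3P[/= uv /eqP sv hv] /and3P[/= uv' /eqP sv' hv'].
  have ev := cut u v v' uv sv uv' sv'; subst v'; congr (_, _); apply: val_inj => /=.
  have := lblD u v uv; have := lblD v u (symE u v uv).
  have := lblP u v uv; rewrite sv eqxx /=; move: hv hv'.
  by rewrite -!val_eqE /=; lia.
have [F [F1 F2]] := two_matchings_colouring R1sym R1irr R1fun R2sym R2irr R2fun.
pose f u x := F (inord x, u).
pose mate u := [pick v | sedge u v && (side u == side v)].
have mateP u v : sedge u v -> side u = side v -> mate u = Some v.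
  move=> uv suv; rewrite /mate; case: pickP => [v' /andP[uv' /eqP suv']|/(_ v)].
    by rewrite (cut u v v').
  by rewrite uv suv eqxx.
have mate_other u v v' : sedge u v -> side u <> side v -> mate u = Some v' ->
    lbl u v' <> lbl u v.
  move=> uv suv; rewrite /mate; case: pickP => // v'' /andP[uv' /eqP suv'] [<-].
  by move/lbl_inj => e; apply: suv; rewrite suv' e.
(* The order of the block [lbl u v] at the other end [v] of the matching edge decides whether the
   centre of [u] joins the reversal. *)
pose sw u := if mate u is Some v then if f v (lbl u v) then 3 else lbl u v else 3.
(* Neither [R1] nor [R2] constrains the block towards the mate at [u], so its order can be set to
   increasing. *)
pose fe u x := (if mate u is Some v then lbl u v != x else true) && f u x.
have mate_edge u v : mate u = Some v -> sedge u v.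
  by rewrite /mate; case: pickP => // v' /andP[uv' _] [<-].
have sw3 u : sw u <= 3.
  rewrite /sw; case E: (mate u) => [v|] //; case: ifP => // _.
  by apply/ltnW/lblD/mate_edge.
apply: (colorable_of_words (lbl := lbl) (cen := fun u => centre r (sw u))
  (st := fun u => flipped r (fe u) (sw u))) => //.
- by move=> u; rewrite /centre; case: ifP => h; apply: in_palette; lia.
- by move=> u x y p q x3 y3 xy pr qr; rewrite /flipped; color_arith.
have s2 : (n - (r.*2).+1) %% (r.*2).+1 <= r.*2.
  by have := ltn_pmod (n - (r.*2).+1) (ltn0Sn r.*2); lia.
move: (_ %% _) rs s2 => s rs s2 u v uv.
have vu := symE u v uv; have lab := lblP u v uv.
have a3 := lblD u v uv; have b3 := lblD v u vu.
(* On an edge of the cut the common label differs from the labels of the matching edges at both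
   ends, so the exceptions in [sw] and [fe] do not affect its block. *)
have [suv|suv] := eqVneq (side u) (side v); last first.
  move: lab; rewrite suv => /eqP elab; rewrite -elab.
  have nsw z z' : sedge z z' -> side z <> side z' -> sw z <> lbl z z'.
    move=> zz' nz; rewrite /sw; case E: (mate z) => [v'|]; last first.
      by have := lblD z z' zz'; lia.
    case: ifP => _; first by have := lblD z z' zz'; lia.
    exact: mate_other E.
  have nfe z z' : sedge z z' -> side z <> side z' -> fe z (lbl z z') = f z (lbl z z').
    move=> zz' nz; rewrite /fe; case E: (mate z) => [v'|] //.
    by rewrite (introF eqP (mate_other _ _ _ zz' nz E)).
  apply: word_equal_labels => //.
  - by apply: nsw => //; apply/eqP.
  - by rewrite elab; apply: nsw => //; apply/nesym/eqP.
  - have -> : fe v (lbl u v) = f v (lbl u v).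
      by rewrite elab; apply: nfe => //; apply/nesym/eqP.
    rewrite nfe //; last exact/eqP.
    suff -> : f v (lbl u v) = ~~ f u (lbl u v) by rewrite negbK.
    by apply: F1; rewrite /R1 /= eqxx uv suv inordK // -elab eqxx.
have mu := mateP u v uv suv; have mv := mateP v u vu (esym suv).
have ab : lbl u v <> lbl v u by apply/eqP; rewrite lab suv eqxx.
have flip_ab : f v (lbl u v) = ~~ f u (lbl v u).
  by apply: F2; rewrite /R2 /= uv suv !inordK // !eqxx orbT.
have [c [c3 ac bc csum]] : exists c, [/\ c < 3, lbl u v <> c, lbl v u <> c &
    c + lbl u v + lbl v u = 3].
  by exists (3 - lbl u v - lbl v u); split; lia.
have flip_c : f v c = ~~ f u c.
  by apply: F2; rewrite /R2 /= uv suv !inordK // csum !eqxx.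
have feE z z' x : mate z = Some z' -> lbl z z' <> x -> fe z x = f z x.
  by move=> mz nx; rewrite /fe mz; case: eqP.
have fe_leaf z z' : mate z = Some z' -> fe z (lbl z z') = false.
  by move=> mz; rewrite /fe mz eqxx.
(* By [flip_ab] exactly one end has its centre reversed, here [v], so the word is built from [v] and
   then read backwards. *)
case fv: (f v (lbl u v)).
  have fu : f u (lbl v u) = false by move: flip_ab; rewrite fv => /esym/negbTE.
  have -> : sw u = 3 by rewrite /sw mu fv.
  have -> : sw v = lbl v u by rewrite /sw mv fu.
  have [w ew] : exists w, edge_word 3 r (r.*2 + s).+1
      (centre r (lbl v u)) (flipped r (fe v) (lbl v u)) (lbl v u)
      (centre r 3) (flipped r (fe u) 3) (lbl u v) w.
    apply: (word_distinct_labels (c := c)); rewrite ?fe_leaf //.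
    - exact: nesym.
    - by rewrite (feE u v).
    - by rewrite (feE v u) //; apply: nesym.
    - by rewrite (feE u v) // (feE v u).
  by exists (fun p => w ((r.*2 + s).+1 - p)); apply: edge_word_rev ew; lia.
have fu : f u (lbl v u) = true by move: flip_ab; rewrite fv; case: (f u _).
have -> : sw u = lbl u v by rewrite /sw mu fv.
have -> : sw v = 3 by rewrite /sw mv fu.
apply: (word_distinct_labels (c := c)); rewrite ?fe_leaf //.
- by rewrite (feE v u) //; apply: nesym.
- by rewrite (feE u v).
- by rewrite (feE u v) // (feE v u) // flip_c negbK.
Qed.

Theorem theorem1 (G : sgraph) (m n : nat) :
  3 <= max_degree G -> 1 < m -> m < n -> ~~ odd m ->
  chromatic_number (frac_power G m n) = clique_number (frac_power G m n).
Proof.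
move=> D3 m1 mn /even_halfK; set r := m./2 => em; rewrite -em in m1 mn *.
apply/eqP; rewrite eqn_leq clique_le_chromatic andbT.
have [u Du] : exists u : G, degree u = max_degree G.
  have [u _|G0] := pickP G; last by move: D3; rewrite /max_degree big_pred0.
  by case: (@eq_bigmax G (@degree G)) => [|v e]; [apply/card_gt0P; exists u|exists v].
apply: leq_trans (ball_clique u mn); rewrite Du.
suff : colorable (frac_power G r.*2 n) (r * max_degree G).+1.
  by rewrite /chromatic_number; case: ex_minnP => k _; apply.
have [D4|D3'] := ltnP 3 (max_degree G); first exact: colorable_large_degree.
have -> : max_degree G = 3 by lia.
have [sr|rs] := leqP ((n - (r.*2).+1) %% (r.*2).+1) r.
  exact: colorable_short_middle.
by apply: colorable_long_middle => //; lia.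
Qed.
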